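(* Let the control-model assumptions in the context hold, let $d$ be the relative-entropy prox-function and $y_\eta^\star(\rho,\alpha)$ the maximizer defined in the context. Then for every $\eta>0$, every $\rho\in\mathbb R$ and every $\alpha\in\mathbb R^n$ with $\|\alpha\|_{\mathfrak R}\le\theta_{\mathcal P}$, $$d\big(y_\eta^\star(\rho,\alpha)\big)\le\mathsf C\max\{\log(\mathsf c\,\eta^{-1}),1\},$$ where $$\mathsf C:=\dim(K),\qquad\mathsf c:=\frac{e}{\dim(K)}\big(\theta_{\mathcal P}\,\varrho_n(\max\{L_Q,1\}+1)+\|\psi\|_{\rm L}\big),\qquad\varrho_n:=\sup_{\|\alpha\|_{\mathfrak R}\le1}\|\alpha\|_{\ell_1}.$$
   Context: Control model: $S$ and $A$ are unit hypercubes and $K=S\times A=[0,1]^{\dim(S\times A)}$. $Q$ is a stochastic kernel on $S$ given $K$, $Qu(s,a):=\int_Su(s')Q(\mathrm ds'|s,a)$, and there is $L_Q>0$ with $|Qu(k)-Qu(k')|\le L_Q\|u\|_\infty\|k-k'\|_{\ell_\infty}$ for all $k,k'\in K$ and all continuous $u:S\to\mathbb R$. The cost $\psi:K\to\mathbb R$ is non-negative and Lipschitz with respect to $\ell_\infty$. For a function $u$ on $S$ (or $K$), $\|u\|_\infty=\sup|u|$ and $\|u\|_{\rm L}:=\max\{\|u\|_\infty,\sup_{s\ne s'}|u(s)-u(s')|/\|s-s'\|_{\ell_\infty}\}$. $(Q-I)u(s,a):=Qu(s,a)-u(s)$. $u_1,\dots,u_n$ are linearly independent Lipschitz functions on $S$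 with $\|u_i\|_{\rm L}=1$; $\|\cdot\|_{\mathfrak R}$ is a norm on $\mathbb R^n$; $\theta_{\mathcal P}>0$. $\mathscr Y$ is the set of Borel probability measures on $K$, $\lambda$ is the uniform probability measure on $K$, and $$d(y):=\int_K\log\Big(\frac{\mathrm dy}{\mathrm d\lambda}\Big)\mathrm dy\ \text{ if }y\ll\lambda,\qquad d(y):=\infty\text{ otherwise}.$$ For $\eta>0$, $(\rho,\alpha)\in\mathbb R\times\mathbb R^n$ and $g:=-\psi+\rho-\sum_{i=1}^n\alpha_i(Q-I)u_i$ (a function on $K$), $y_\eta^\star(\rho,\alpha):=\arg\max_{y\in\mathscr Y}\{\int_Kg\,\mathrm dy-\eta\,d(y)\}$, which is known to be the measure with density $\exp(\eta^{-1}g)/\int_K\exp(\eta^{-1}g)\,\mathrm d\lambda$ with respect to $\lambda$. *)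

(* Defs.v *)
From HB Require Import structures.
From mathcomp Require Import all_boot all_order all_algebra.
From mathcomp Require Import all_classical all_reals all_analysis.
From mathcomp Require Import measurable_realfun.

Set Implicit Arguments.
Unset Strict Implicit.
Unset Printing Implicit Defensive.

Import Order.TTheory GRing.Theory Num.Theory.
Import numFieldNormedType.Exports.

Local Open Scope classical_set_scope.
Local Open Scope ring_scope.

Definition cube (R : realType) (d : nat) : Type :=
  set_type [set x : 'rV[R]_d | forall i, 0 <= x ord0 i <= 1].

Section cube_structures.
Variables (R : realType) (d : nat).

#[warnings="-redundant-canonical-projection"]
HB.instance Definition _ := PseudoMetric.copy (cube R d)
  (set_type [set x : 'rV[R]_d | forall i, 0 <= x ord0 i <= 1]).

Definition cube_val (x : cube R d) : 'rV[R]_d := set_val x.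

Lemma cube_valP (x : cube R d) i : 0 <= cube_val x ord0 i <= 1.
Proof. by case: x => x xP; exact: (set_mem xP). Qed.

Definition mk_cube (x : 'rV[R]_d) (x01 : forall i, 0 <= x ord0 i <= 1) :
  cube R d := exist _ x (mem_set x01).

Lemma cube0_subproof i : 0 <= (0 : 'rV[R]_d) ord0 i <= 1.
Proof. by rewrite mxE lexx ler01. Qed.

HB.instance Definition _ :=
  isPointed.Build (cube R d) (mk_cube cube0_subproof).

(* the Borel sigma-algebra of the subspace topology *)
HB.instance Definition _ :=
  Measurable.copy (cube R d) (g_sigma_algebraType (@open (cube R d))).

(* the norm of ['rV[R]_d] is the l_infty norm *)
Definition cube_dist (x y : cube R d) : R := `|cube_val x - cube_val y|.

End cube_structures.

Section uniform_measure.
Variable R : realType.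

Lemma measurable_to_cube (d : nat) (disp : measure_display)
    (T : measurableType disp) (f : T -> cube R d) :
  (forall i, measurable_fun [set: T] (fun t => cube_val (f t) ord0 i)) ->
  measurable_fun [set: T] f.
Proof.
move=> mf; apply: (@measurability _ _ _ _ _ _ (@open (cube R d))) => //.
move=> _ [U oU <-]; rewrite setTI.
have [V oV UV] : exists2 V : set 'rV[R]_d, open V & U = @cube_val R d @^-1` V.
  by case: oU => V oV <-; exists V.
pose B (qn : 'rV[rat]_d * nat) : set 'rV[R]_d :=
  [set x | forall i, `|x ord0 i - ratr (qn.1 ord0 i)| < qn.2.+1%:R^-1].
pose F qn : set T :=
  if `[< B qn `<=` V >] then (fun t => cube_val (f t)) @^-1` (B qn) else set0.
suff -> : f @^-1` U = \bigcup_qn F qn.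
  apply: countable_bigcupT_measurable; first exact: countableP.
  move=> [q n]; rewrite /F; case: ifP => // _.
  rewrite (_ : _ @^-1` _ = \bigcap_i
    [set t | `|cube_val (f t) ord0 i - ratr (q ord0 i)| < n.+1%:R^-1]).
    apply: fin_bigcap_measurable => // i _.
    rewrite -[X in measurable X]setTI.
    have mB : measurable (ball (ratr (q ord0 i) : R) n.+1%:R^-1).
      exact: measurable_ball.
    have := mf i measurableT _ mB; congr (measurable (_ `&` _)).
    by apply/seteqP; split=> t; rewrite /= /ball/= distrC.
  by apply/seteqP; split => t /= Ht i => [_|]; exact: Ht.
rewrite UV; apply/seteqP; split => t /=; last first.
  by move=> [qn _]; rewrite /F; case: ifPn => // /asboolP + Bt; apply.
move=> Vt; have /nbhs_ballP[e /= e0 eV] : nbhs (cube_val (f t)) V.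
  exact: open_nbhs_nbhs.
have e20 : 0 < e / 2 by rewrite divr_gt0.
pose n := Num.truncn (e / 2)^-1.
have ne : n.+1%:R^-1 < e / 2.
  by rewrite invf_plt ?posrE// truncnS_gt.
have n0 : 0 < n.+1%:R^-1 :> R by rewrite invr_gt0.
have qP i : exists q : rat, `|cube_val (f t) ord0 i - ratr q| < n.+1%:R^-1.
  have : cube_val (f t) ord0 i < cube_val (f t) ord0 i + n.+1%:R^-1.
    by rewrite ltrDl.
  move=> /rat_in_itvoo[q]; rewrite in_itv/= => /andP[q1 q2]; exists q.
  by rewrite ltr0_norm ?subr_lt0// opprB ltrBlDl.
have [q {}qP] := choice qP.
exists (\row_i q i, n) => //; rewrite /F; case: ifPn => [_ i|/asboolP].
  by rewrite /= mxE; exact: qP.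
case=> x Bx; apply: eV; rewrite mx_norm_ball /ball_/=.
rewrite [ltLHS]mx_normrE; apply/bigmax_ltP; split => // -[i j] _ /=.
rewrite (ord1 i) !mxE -(subrK (ratr (q j)) (cube_val _ _ _)) -addrA.
rewrite (le_lt_trans (ler_normD _ _))// [e]splitr ltrD//.
  exact: lt_trans (qP j) ne.
by rewrite distrC (lt_trans _ ne)//; have := Bx j; rewrite /= mxE.
Qed.


Section tuple_cons.
Variable d : nat.

Definition tuple_cons (xt : measurableTypeR R * d.-tuple (measurableTypeR R)) :
  d.+1.-tuple (measurableTypeR R) := [tuple of xt.1 :: xt.2].

Lemma measurable_tuple_cons : measurable_fun [set: _] tuple_cons.
Proof. exact: measurable_cons. Qed.

HB.instance Definition _ :=
  isMeasurableFun.Build _ _ _ _ tuple_cons measurable_tuple_cons.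

End tuple_cons.

(* the law of d independent uniform random variables on [0, 1] *)
Fixpoint tuple_uniform (d : nat) : probability (d.-tuple (measurableTypeR R)) R :=
  if d is d'.+1 then
    distribution (uniform_prob (@ltr01 R) \x tuple_uniform d')%E (@tuple_cons d')
  else dirac [tuple].

Section clamp.
Variable d : nat.

Definition clamp01 (x : R) : R := Num.max 0 (Num.min x 1).

Lemma clamp01P (t : d.-tuple (measurableTypeR R)) i :
  0 <= (\row_j clamp01 (tnth t j) : 'rV[R]_d) ord0 i <= 1.
Proof.
by rewrite mxE /clamp01 le_max lexx/= ge_max ler01/= ge_min lexx orbT.
Qed.

Definition cube_of_tuple (t : d.-tuple (measurableTypeR R)) : cube R d :=
  mk_cube (clamp01P t).

Lemma measurable_cube_of_tuple : measurable_fun [set: _] cube_of_tuple.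
Proof.
apply: measurable_to_cube => i.
rewrite (_ : (fun t => _) = clamp01 \o (@tnth d R ^~ i)); last first.
  by apply/funext => t; rewrite /cube_val/= mxE.
apply: measurableT_comp; last exact: measurable_tnth.
by apply: measurable_maxr => //; exact: measurable_minr.
Qed.

HB.instance Definition _ :=
  isMeasurableFun.Build _ _ _ _ cube_of_tuple measurable_cube_of_tuple.

(* [tuple_uniform] is concentrated on [0, 1]^d, where the clamping in
   [cube_of_tuple] is the identity *)
Definition cube_uniform : probability (cube R d) R :=
  distribution (tuple_uniform d) cube_of_tuple.

End clamp.

Lemma uniform_prob01_clamp (a b : R) : 0 <= a -> a <= b -> b <= 1 ->
  uniform_prob (@ltr01 R) [set x | a <= clamp01 x <= b] = (b - a)%:E.
Proof.
move=> a0 ab b1; rewrite /uniform_prob integral_uniform_pdf.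
have clE (x : R) : 0 <= x <= 1 -> clamp01 x = x.
  by move=> /andP[x0 x1]; rewrite /clamp01 (min_idPl x1) (max_idPr x0).
rewrite (_ : _ `&` _ = `[a, b]%classic); last first.
  apply/seteqP; split=> x /=; rewrite !in_itv/=.
    by move=> [+ x01]; rewrite clE.
  move=> /andP[ax xb].
  have x01 : 0 <= x <= 1 by rewrite (le_trans a0 ax) (le_trans xb b1).
  by rewrite clE// ax xb.
rewrite (eq_integral (cst 1%E)) => [|x]; last first.
  rewrite inE/= in_itv/= => /andP[ax xb].
  by rewrite /uniform_pdf (le_trans a0 ax) (le_trans xb b1)/= subr0 invr1.
rewrite integral_cst//= mul1e lebesgue_measure_itv/= lte_fin.
move: ab; rewrite le_eqVlt => /predU1P[->|ab]; last by rewrite ab EFinB.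
by rewrite ltxx subrr.
Qed.

Lemma cube_uniform_box (d : nat) (a b : 'I_d -> R) :
  (forall i, 0 <= a i) -> (forall i, a i <= b i) -> (forall i, b i <= 1) ->
  cube_uniform d [set x | forall i, a i <= cube_val x ord0 i <= b i] =
  (\prod_i (b i - a i))%:E.
Proof.
move=> a0 ab b1; rewrite /cube_uniform/= /distribution /pushforward/=.
rewrite (_ : _ @^-1` _ = [set t | forall i, a i <= clamp01 (tnth t i) <= b i]);
  last first.
  by apply/seteqP; split=> t /= H i; have := H i; rewrite /cube_val/= mxE.
elim: d a b a0 ab b1 => [|d IH] a b a0 ab b1.
  rewrite big_ord0/= diracE mem_set//=.
  by case.
rewrite big_ord_recl EFinM/= /distribution /pushforward/=.
rewrite (_ : _ @^-1` _ = [set x | a ord0 <= clamp01 x <= b ord0] `*`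
  [set t | forall i, a (lift ord0 i) <= clamp01 (tnth t i) <= b (lift ord0 i)]);
  last first.
  apply/seteqP; split=> -[x t] /=.
    move=> H; split=> [|i]; first exact: (H ord0).
    by have := H (lift ord0 i); rewrite tnthS.
  move=> [H0 H] i; case: (unliftP ord0 i) => [j ->|->]; last exact: H0.
  by rewrite tnthS.
have mcl (x y : R) : measurable [set z : measurableTypeR R | x <= clamp01 z <= y].
  have mc : measurable_fun [set: measurableTypeR R] clamp01.
    by apply: measurable_maxr => //; exact: measurable_minr.
  have := mc measurableT _ (measurable_itv `[x, y]); rewrite setTI.
  by congr measurable; apply/seteqP; split=> z; rewrite /= in_itv.
rewrite product_measure1E//=.
  by rewrite uniform_prob01_clamp// IH.
rewrite (_ : mkset _ = \bigcap_i ((@tnth d R ^~ i) @^-1`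
    [set z | a (lift ord0 i) <= clamp01 z <= b (lift ord0 i)])).
    apply: fin_bigcap_measurable => // i _; rewrite -[X in measurable X]setTI.
    exact: measurable_tnth.
  by apply/seteqP; split=> t /= H i => [_|]; exact: H.
Qed.

End uniform_measure.

Section control_model.
Variable R : realType.

Definition lipschitz_cube (d : nat) (f : cube R d -> R) : Prop :=
  exists L : R, forall x y, `|f x - f y| <= L * cube_dist x y.

Definition sup_norm (d : nat) (f : cube R d -> R) : R :=
  sup [set `|f x| | x in [set: cube R d]].

Definition lip_norm (d : nat) (f : cube R d -> R) : R :=
  Num.max (sup_norm f)
    (sup [set r : R | exists x y : cube R d,
            x <> y /\ r = `|f x - f y| / cube_dist x y]).

Definition lin_indep (n d : nat) (u : 'I_n -> cube R d -> R) : Prop :=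
  forall c : 'I_n -> R,
    (forall x, \sum_i c i * u i x = 0) -> forall i, c i = 0.

Definition is_norm (n : nat) (N : 'rV[R]_n -> R) : Prop :=
  [/\ forall x y, N (x + y) <= N x + N y,
      forall (c : R) x, N (c *: x) = `|c| * N x &
      forall x, N x = 0 -> x = 0].

Definition l1_norm (n : nat) (x : 'rV[R]_n) : R := \sum_i `|x ord0 i|.

Definition varrho (n : nat) (N : 'rV[R]_n -> R) : R :=
  sup [set l1_norm x | x in [set x | N x <= 1]].

Section kernel_operator.
Variables p q : nat.

Lemma state_subproof (k : cube R (p + q)) i :
  0 <= (lsubmx (cube_val k) : 'rV[R]_p) ord0 i <= 1.
Proof. by rewrite mxE; exact: cube_valP. Qed.

(* the component s of k = (s, a), with S * A identified with [0, 1]^(p + q) *)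
Definition state (k : cube R (p + q)) : cube R p := mk_cube (state_subproof k).

Variable Q : R.-pker (cube R (p + q)) ~> (cube R p).

Definition Qop (u : cube R p -> R) (k : cube R (p + q)) : R :=
  \int[Q k]_s u s.

Definition QIop (u : cube R p -> R) (k : cube R (p + q)) : R :=
  Qop u k - u (state k).

Definition Q_lipschitz (L : R) : Prop :=
  forall u : cube R p -> R, continuous u -> forall k k',
    `|Qop u k - Qop u k'| <= L * sup_norm u * cube_dist k k'.

Definition gain (n : nat) (psi : cube R (p + q) -> R)
    (u : 'I_n -> cube R p -> R) (rho : R) (alpha : 'rV[R]_n)
    (k : cube R (p + q)) : R :=
  - psi k + rho - \sum_i alpha ord0 i * QIop (u i) k.

End kernel_operator.

Local Open Scope ereal_scope.
Local Open Scope charge_scope.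

Definition rel_entropy (d : nat) (y : probability (cube R d) R) : \bar R :=
  if `[< y `<< cube_uniform R d >] then
    \int[y]_k lne (('d (charge_of_finite_measure y) '/d (cube_uniform R d)) k)
  else +oo.

Definition entropic_objective (d : nat) (g : cube R d -> R) (eta : R)
    (y : probability (cube R d) R) : \bar R :=
  \int[y]_k (g k)%:E - eta%:E * rel_entropy y.

Definition entropic_argmax (d : nat) (g : cube R d -> R) (eta : R) :
    set (probability (cube R d) R) :=
  [set y | forall z, entropic_objective g eta z <= entropic_objective g eta y].

End control_model.

(* Main.v *)
Require Import Defs.
From HB Require Import structures.
From mathcomp Require Import all_boot all_order all_algebra.
From mathcomp Require Import all_classical all_reals all_analysis.
From mathcomp Require Import measurable_realfun ring lra.
Import Order.TTheory GRing.Theory Num.Theory.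
Import numFieldNormedType.Exports.
Local Open Scope classical_set_scope.
Local Open Scope ring_scope.

(* The explicit form of the maximizer y' is not needed: it suffices to compare
   it with one competitor.  Let L be a Lipschitz constant of the gain g, D the
   dimension of K, x an almost maximal point of g and z the uniform law on a
   sub-box of K of side r <= 1 within distance r of x.  Optimality of y' gives
     eta d(y') <= sup g - \int g dz + eta d(z) <= L r + eta D ln (1 / r)
   up to an arbitrarily small error, and r = min (1, D eta / L) yields the
   bound.  The Lipschitz constant involves ||alpha||_1 <= theta varrho_n, where
   varrho_n is a genuine supremum because all norms on R^n are equivalent. *)

(** * Equivalence of norms on row vectors and finiteness of [varrho] *)

Section row_norm.
Context {R : realType} {n : nat}.
Implicit Types (x : 'rV[R]_n) (N : 'rV[R]_n -> R).

Lemma ler_rV_norm x i : `|x ord0 i| <= `|x|.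
Proof.
rewrite [leRHS]mx_normrE.
exact: (@le_bigmax _ _ _ 0 (fun ij : 'I_1 * 'I_n => `|x ij.1 ij.2|) (ord0, i)).
Qed.

Lemma rV_norm_le x (r : R) : 0 <= r -> (forall i, `|x ord0 i| <= r) -> `|x| <= r.
Proof.
move=> r0 xr; rewrite [leLHS]mx_normrE; apply/bigmax_leP; split => //.
by move=> [i j] _ /=; rewrite (ord1 i).
Qed.

Lemma l1_norm_le x : l1_norm x <= n%:R * `|x|.
Proof.
rewrite /l1_norm (le_trans (ler_sum _ (fun i _ => ler_rV_norm x i)))//.
by rewrite sumr_const card_ord mulr_natl.
Qed.

Lemma is_norm_sum {N} : is_norm N ->
  forall (I : Type) (s : seq I) (F : I -> 'rV[R]_n),
  N (\sum_(i <- s) F i) <= \sum_(i <- s) N (F i).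
Proof.
move=> [ND NZ _] I s F; elim: s => [|i s IH].
  by rewrite !big_nil -(scale0r 0) NZ normr0 mul0r.
by rewrite !big_cons (le_trans (ND _ _))// lerD2l.
Qed.

(** Subadditivity at [x] and [- x], which have the same norm, gives [0 <= N x + N x]. *)
Lemma is_norm_ge0 {N} x : is_norm N -> 0 <= N x.
Proof.
move=> [ND NZ _]; have := ND x (- x).
rewrite subrr -(scale0r 0) NZ normr0 mul0r -scaleN1r NZ normrN1 mul1r.
by rewrite -mulr2n pmulrn_lge0.
Qed.

(** Expand [x] in the standard basis and bound each coordinate by the sup norm. *)
Lemma is_norm_le {N} : is_norm N ->
  exists2 K : R, 0 <= K & forall x, N x <= K * `|x|.
Proof.
move=> hN; exists (\sum_i N 'e_i).
  by apply: sumr_ge0 => i _; exact: is_norm_ge0.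
move=> x; rewrite {1}[x]row_sum_delta (le_trans (is_norm_sum hN _ _ _))//.
rewrite mulr_suml ler_sum// => i _; case: hN (hN) => _ -> _ hN.
by rewrite mulrC ler_wpM2l ?ler_rV_norm ?is_norm_ge0.
Qed.

Lemma is_norm_continuous N : is_norm N -> continuous N.
Proof.
move=> hN; have [K K0 NK] := is_norm_le hN; have [ND NZ _] := hN.
have NB x y : N x - N y <= K * `|x - y|.
  by rewrite lerBlDr (le_trans _ (lerD (NK _) (lexx _)))// -{1}(subrK y x) ND.
move=> x; apply/(@cvgrPdist_le _ _ _ (nbhs x) (nbhs_filter x)) => e e0.
near=> y; rewrite (@le_trans _ _ (K * `|x - y|))//.
  by rewrite ler_norml NB lerNl opprB distrC NB.
rewrite (@le_trans _ _ ((K + 1) * `|x - y|))// ?ler_wpM2r ?lerDl//.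
rewrite mulrC -ler_pdivlMr ?ltr_wpDl//.
near: y; apply: cvgr_dist_le; first exact: cvg_id.
by rewrite divr_gt0// ltr_wpDl.
Unshelve. all: by end_near. Qed.

(** [N] is continuous, so it attains its minimum on the compact unit sphere; definiteness makes this
    minimum positive, and homogeneity extends the bound to all vectors. *)
Lemma is_norm_ge {N} : is_norm N ->
  exists2 m : R, 0 < m & forall x, m * `|x| <= N x.
Proof.
move=> hN; pose S : set 'rV[R]_n := [set x | `|x| = 1].
(* The sphere is empty only if every vector is 0 ([n = 0]); any positive constant then works. *)
have [S0|S0] := pselect (S !=set0); last first.
  exists 1 => // x; have [->|x0] := eqVneq x 0.
    by rewrite normr0 mulr0 is_norm_ge0.
  exfalso; apply: S0; exists (`|x|^-1 *: x); rewrite /S/= normrZ.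
  by rewrite ger0_norm ?invr_ge0// mulVf// normr_eq0.
have cS : compact S.
  apply: bounded_closed_compact.
    by exists 1; split => // M M1 x /= ->; exact: ltW.
  rewrite (_ : S = (fun x : 'rV[R]_n => `|x|) @^-1` [set 1])//.
  apply: closed_comp; last exact: closed_eq.
  by move=> x _; exact: norm_continuous.
have [|c cS' cmin] := @compact_EVT_min _ _ N S S0 cS.
  by apply: continuous_subspaceT; exact: is_norm_continuous.
have c1 : `|c| = 1 by exact: set_mem cS'.
exists (N c) => [|x].
  rewrite lt_neqAle is_norm_ge0// andbT eq_sym; apply/eqP.
  case: hN => _ _ /[apply] c0.
  by move: c1; rewrite c0 normr0 => /esym/eqP; rewrite oner_eq0.
have [->|x0] := eqVneq x 0; first by rewrite normr0 mulr0 is_norm_ge0.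
have nx0 : 0 < `|x| by rewrite normr_gt0.
have := cmin (`|x|^-1 *: x); case: (hN) => _ -> _.
rewrite gtr0_norm ?invr_gt0// ler_pdivlMl// mulrC; apply.
by apply/mem_set; rewrite /S/= normrZ gtr0_norm ?invr_gt0// mulVf ?gt_eqF.
Qed.

(** Rescaling by [t^-1] lands in the unit ball of [N]. The lower bound on [N] makes the l1 norm
    bounded there, so that the [sup] is a true upper bound. *)
Lemma l1_norm_le_varrho {N} (t : R) x : is_norm N -> 0 < t -> N x <= t ->
  l1_norm x <= t * varrho N.
Proof.
move=> hN t0 xt; have [m m0 Nm] := is_norm_ge hN.
rewrite mulrC -ler_pdivrMr//.
have -> : l1_norm x / t = l1_norm (t^-1 *: x).
  rewrite /l1_norm mulr_suml; apply: eq_bigr => i _.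
  by rewrite mxE normrM gtr0_norm ?invr_gt0// mulrC.
apply: ub_le_sup; last first.
  exists (t^-1 *: x) => //=; case: hN => _ -> _.
  by rewrite gtr0_norm ?invr_gt0// ler_pdivrMl// mulr1.
exists (n%:R / m) => _ [y /= y1 <-]; rewrite (le_trans (l1_norm_le _))//.
by rewrite ler_wpM2l// -[m^-1]mul1r ler_pdivlMr// mulrC (le_trans (Nm y)).
Qed.

End row_norm.

(** * Lipschitz functions and sub-boxes of the cube *)

Section cube_lipschitz.
Context {R : realType} {d : nat}.
Implicit Types (f : cube R d -> R) (x y : cube R d).

Lemma cube_dist_ge0 x y : 0 <= cube_dist x y.
Proof. exact: normr_ge0. Qed.

Lemma cube_dist_le1 x y : cube_dist x y <= 1.
Proof.
apply: rV_norm_le => // i; rewrite !mxE ler_norml.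
have := cube_valP x i; have := cube_valP y i; lra.
Qed.

Lemma lipschitz_cube_continuous f : lipschitz_cube f -> continuous f.
Proof.
move=> [L fL] x; apply/(@cvgrPdist_le _ _ _ (nbhs x) (nbhs_filter x)) => e e0.
(* [L] may be zero or negative; [|L| + 1] is a positive constant to divide by. *)
have K0 : 0 < `|L| + 1 by rewrite ltr_wpDl.
near=> y.
have xy : cube_dist x y <= e / (`|L| + 1).
  near: y; apply/nbhs_ballP; exists (e / (`|L| + 1)) => /=.
    by rewrite divr_gt0.
  move=> y; rewrite -initial_ballE /= mx_norm_ball => /ltW.
  exact.
rewrite (le_trans (fL _ _))// (@le_trans _ _ ((`|L| + 1) * cube_dist x y))//.
  by rewrite ler_wpM2r ?normr_ge0// (le_trans (ler_norm _))// lerDl.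
by rewrite mulrC -ler_pdivlMr.
Unshelve. all: by end_near. Qed.

Lemma continuous_cube_measurable f : continuous f ->
  measurable_fun [set: cube R d] f.
Proof.
move=> /continuousP cf; apply: (measurability _ (RGenOpens.measurableE R)).
move=> _ [_ [a [b ->] <-]]; rewrite setTI; apply: sub_sigma_algebra.
exact/cf/interval_open.
Qed.

(** The Lipschitz hypothesis bounds the difference quotients, so their [sup] dominates each of
    them. *)
Lemma lip_norm_lipschitz f x y : lipschitz_cube f ->
  `|f x - f y| <= lip_norm f * cube_dist x y.
Proof.
move=> [L fL]; have [->|xy] := pselect (x = y).
  by rewrite /cube_dist !subrr !normr0 mulr0.
have pos a b : a <> b -> 0 < @cube_dist R d a b.
  move=> ab; rewrite normr_gt0 subr_eq0; apply/eqP => /val_inj; exact: ab.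
rewrite -ler_pdivrMr ?pos// le_max; apply/orP; right.
apply: ub_le_sup; last by exists x, y.
exists L => _ [a [b [ab ->]]]; rewrite ler_pdivrMr ?pos//.
Qed.

(** A set without a supremum has [sup] equal to 0, so the sign does not depend on [f] being
    bounded. *)
Lemma lip_norm_ge0 f : 0 <= lip_norm f.
Proof.
rewrite le_max; apply/orP; left; rewrite /sup_norm.
set S := (X in sup X); have [hs|/sup_out ->//] := pselect (has_sup S).
apply: le_trans (normr_ge0 (f point)) _.
by apply: sup_upper_bound => //; exists point.
Qed.

Lemma cube_box x (r : R) : 0 <= r -> r <= 1 -> exists a : 'I_d -> R,
  [/\ forall i, 0 <= a i, forall i, a i + r <= 1 &
   forall y, (forall i, a i <= cube_val y ord0 i <= a i + r) -> cube_dist x y <= r].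
Proof.
(* The lower corner is [x] itself, pulled back to [1 - r] in the coordinates where the box would
   leave the cube; the box still contains [x]. *)
move=> r0 r1; exists (fun i => Num.min (cube_val x ord0 i) (1 - r)).
have xP := cube_valP x.
split=> [i|i|y yr].
- by rewrite le_min subr_ge0 r1 andbT; have /andP[] := xP i.
- by rewrite -lerBrDr ge_min lexx orbT.
apply: rV_norm_le => // i; rewrite !mxE ler_norml.
by have := yr i; have := xP i; case: (leP _ (1 - r)) => ?; lra.
Qed.

Lemma measurable_box (a b : 'I_d -> R) :
  measurable [set x : cube R d | forall i, a i <= cube_val x ord0 i <= b i].
Proof.
rewrite (_ : mkset _ = \bigcap_i ((fun x : cube R d => cube_val x ord0 i) @^-1`
    [set` `[a i, b i]])).
  apply: fin_bigcap_measurable => // i _; rewrite -[X in measurable X]setTI.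
  have mi : measurable_fun [set: cube R d] (fun x => cube_val x ord0 i).
    apply: continuous_cube_measurable; apply: lipschitz_cube_continuous.
    exists 1 => x y.
    by rewrite mul1r (le_trans _ (ler_rV_norm _ i))// !mxE.
  by apply: mi => //; exact: measurable_itv.
by apply/seteqP; split=> x /= H i => [_|]; have := H i; rewrite /= in_itv//=; exact.
Qed.

End cube_lipschitz.

(** * Relative entropy of a law conditioned on a set [B] *)

Section entropy.
Local Open Scope ereal_scope.
Local Open Scope charge_scope.

Lemma measurable_lne (R : realType) : measurable_fun [set: \bar R] (@lne R).
Proof.
rewrite (_ : @lne R = fun x => if x <= 0 then -oo else
    if x == +oo then +oo else (ln (fine x))%:E); last first.
  by apply/funext => -[r| |]; rewrite ?lee_fin ?leye_eq ?leNye.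
apply: measurable_fun_ifT => //.
  by apply: measurable_fun_lee.
apply: measurable_fun_ifT => //.
  by apply: measurable_fun_eqe.
apply/measurable_EFinP; apply: measurableT_comp; first exact: measurable_ln.
exact: fine_measurable.
Qed.

Context {d : measure_display} {T : measurableType d} {R : realType}.
Variables (mu : probability T R) (B : set T) (mB : measurable B).
Variables (v : R) (v0 : (0 < v)%R) (muB : mu B = v%:E).

Lemma cond_prob_ex : exists z : probability T R,
  forall A, z A = mu (A `&` B) * v^-1%:E.
Proof.
(* The second [mu] is the default law for mass 0 or infinity, excluded here because the mass is
   [v]. *)
exists (mnormalize (mrestr mu mB) mu) => A.
have E : mrestr mu mB setT = v%:E by rewrite /mrestr setTI.
by rewrite /= /mnormalize/= E eqe gt_eqF.
Qed.

Variables (z : probability T R) (zE : forall A, z A = mu (A `&` B) * v^-1%:E).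

Lemma cond_prob_dominates : z `<< mu.
Proof.
apply/null_content_dominatesP => A mA muA0; rewrite zE.
rewrite (_ : mu _ = 0) ?mul0e//.
by apply: subset_measure0 muA0 => //; exact: measurableI.
Qed.

Lemma cond_prob_setC : z (~` B) = 0.
Proof. by rewrite zE setICl measure0 mul0e. Qed.

Lemma cond_prob_ae (P : T -> Prop) : (forall x, B x -> P x) ->
  {ae z, forall x, P x}.
Proof.
move=> BP; exists (~` B); split => //; first exact: measurableC.
  exact: cond_prob_setC.
by move=> x /=; apply: contra_not; exact: BP.
Qed.

(** The density is [v^-1] on [B] and 0 elsewhere, and [z] is concentrated on [B], so the logarithm
    is [z]-almost everywhere constant. *)
Lemma integral_lne_cond_prob :
  \int[z]_k
    lne (('d (charge_of_finite_measure z) '/d mu) k) = (- ln v)%:E.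
Proof.
set nu := charge_of_finite_measure z.
have num : nu `<< mu by exact: cond_prob_dominates.
have fE : ae_eq mu setT ('d nu '/d mu) (fun x => v^-1%:E * (\1_B x)%:E).
  apply: integral_ae_eq => //.
  - exact: Radon_Nikodym_integrable.
  - apply: emeasurable_funM => //.
    by apply/measurable_EFinP; exact: measurable_indic.
  - move=> E _ mE; rewrite -Radon_Nikodym_integral//.
    rewrite [LHS]zE ge0_integralZl//; last first.
    + by rewrite lee_fin invr_ge0 ltW.
    + by apply/measurable_EFinP; exact: measurable_indic.
    by rewrite integral_indic// setIC muleC.
transitivity (\int[z]_x cst (- ln v)%:E x); last first.
  by rewrite integral_cst//= probability_setT mule1.
apply: ae_eq_integral => //.
  apply: measurableT_comp; first exact: measurable_lne.
  by apply: measurable_int; exact: Radon_Nikodym_integrable.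
(* The density is identified [mu]-almost everywhere; domination transfers this to [z]. *)
have fE' := null_dominates_ae_eq measurableT cond_prob_dominates fE.
have := @cond_prob_ae B (fun x => id).
near_simpl; apply: filterS2 fE' => x /= /(_ Logic.I) -> Bx _.
by rewrite indicE mem_set// mule1 lne_EFin ?invr_gt0// lnV.
Qed.

End entropy.

(** * Entropy bounds for a maximizer *)

Section argmax.
Context {R : realType} {d : nat}.

(** The competitor is the uniform law conditioned on [B]: its entropy is [- ln v] and its mean gain
    at least [m]. *)
Lemma entropic_argmax_le (g : cube R d -> R) (eta M m v : R)
    (y : probability (cube R d) R) (B : set (cube R d)) :
  measurable_fun [set: cube R d] g ->
  [bounded g x | x in [set: cube R d]] -> 0 < eta ->
  (forall x, g x <= M) -> measurable B -> (forall x, B x -> m <= g x) ->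
  0 < v -> cube_uniform R d B = v%:E ->
  entropic_argmax g eta y ->
  (rel_entropy y <= ((M - m) / eta - ln v)%:E)%E.
Proof.
move=> mg bg eta0 gM mB gm v0 lB ymax.
have [z zE] := cond_prob_ex (cube_uniform R d) B mB v v0 lB.
have gi (w : probability (cube R d) R) : w.-integrable setT (EFin \o g).
  by apply: measurable_bounded_integrable => //; rewrite /= probability_setT ltry.
have zent : rel_entropy z = (- ln v)%:E.
  rewrite /rel_entropy; case: ifPn => [_|/asboolP[]].
    exact: (integral_lne_cond_prob _ B mB v v0 z zE).
  exact: (cond_prob_dominates _ B mB v z zE).
have ci (w : probability (cube R d) R) (c : R) : w.-integrable setT (cst c%:E).
  by apply: finite_measure_integrable_cst.
have cE (w : probability (cube R d) R) (c : R) : (\int[w]_x (cst c%:E x) = c%:E)%E.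
  by rewrite integral_cst//= probability_setT mule1.
have zg : (m%:E <= \int[z]_x (g x)%:E)%E.
  have zB : z (~` B) = 0%E by rewrite zE setICl measure0 mul0e.
  have mBC : measurable (~` B) by exact: measurableC.
  have setDB : setT `\` ~` B = B by rewrite setTD setCK.
  rewrite -(cE z m) (negligible_integral mBC measurableT (ci z m) zB).
  rewrite (negligible_integral mBC measurableT (gi z) zB) setDB.
  apply: le_integral => // [| |x /set_mem Bx]; last by rewrite lee_fin; exact: gm.
    exact: integrableS (ci z m).
  exact: integrableS (gi z).
have yg : (\int[y]_x (g x)%:E <= M%:E)%E.
  rewrite -(cE y M); apply: le_integral => // [| |x _]; last by rewrite lee_fin.
    exact: gi.
  exact: ci.
have := ymax z; rewrite /entropic_objective zent.
have [G zG] : exists G, (\int[z]_x (g x)%:E = G%:E)%E.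
  by have /fineK <- := integrable_fin_num measurableT (gi z); eexists.
have [H yH] : exists H, (\int[y]_x (g x)%:E = H%:E)%E.
  by have /fineK <- := integrable_fin_num measurableT (gi y); eexists.
move: zg yg; rewrite zG yH !lee_fin => mG HM.
(* The value [+oo] would make the objective at [y] equal to [-oo], below its finite value at [z]. *)
case: (rel_entropy y) => [r| |].
- rewrite -!EFinM -!EFinB !lee_fin => h.
  rewrite -(ler_pM2l eta0) mulrBr [eta * (_ / _)]mulrC mulfVK ?gt_eqF//; lra.
- by rewrite gt0_muley ?lte_fin//.
- by rewrite leNye.
Qed.

Lemma entropic_argmax_lipschitz (g : cube R d -> R) (eta L r : R)
    (y : probability (cube R d) R) :
  0 < eta -> 0 <= L -> (forall x x', `|g x - g x'| <= L * cube_dist x x') ->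
  0 < r -> r <= 1 -> entropic_argmax g eta y ->
  (rel_entropy y <= (L * r / eta - d%:R * ln r)%:E)%E.
Proof.
move=> eta0 L0 gL r0 r1 ymax.
have gbnd x : `|g x| <= `|g point| + L.
  rewrite -[g x](subrK (g point)) addrC (le_trans (ler_normD _ _))//.
  by rewrite lerD2l (le_trans (gL _ _))// ler_piMr// cube_dist_le1.
have hs : has_sup (range g).
  split; first by exists (g point), point.
  by exists (`|g point| + L) => _ [x _ <-]; exact: le_trans (ler_norm _) (gbnd x).
have mg : measurable_fun [set: cube R d] g.
  apply: continuous_cube_measurable; apply: lipschitz_cube_continuous.
  by exists L.
have bg : [bounded g x | x in [set: cube R d]].
  exists (`|g point| + L); split => [|c cL x _]; first exact: num_real.
  exact: le_trans (gbnd x) (ltW cL).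
have r0' := ltW r0.
apply/lee_addgt0Pr => e e0.
(* A loss of [e * eta] in the gain becomes the slack [e] after division by [eta]. *)
have [_ [x _ <-] xsup] := sup_adherent (mulr_gt0 e0 eta0) hs.
have [a [a0 ar ball_a]] := cube_box x r r0' r1.
set B := [set z : cube R d | forall i, a i <= cube_val z ord0 i <= a i + r].
have lB : cube_uniform R d B = (r ^+ d)%:E.
  rewrite cube_uniform_box// => [|i]; last by rewrite lerDl.
  by under eq_bigr do rewrite addrC addKr; rewrite prodr_const card_ord.
apply: le_trans (entropic_argmax_le g eta (sup (range g))
  (sup (range g) - e * eta - L * r) (r ^+ d) y B mg bg eta0 _ _ _ _ lB ymax) _.
- by move=> z; apply: sup_upper_bound => //; exists z.
- exact: measurable_box.
- move=> z Bz; have := gL x z.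
  rewrite ler_norml => /andP[_ gxz].
  have := ler_wpM2l L0 (ball_a z Bz); lra.
- exact: exprn_gt0.
rewrite -EFinD lee_fin lnXn// -mulr_natl.
rewrite (_ : _ - (_ - _ - _) = e * eta + L * r); last by lra.
by rewrite mulrDl mulfK ?gt_eqF//; lra.
Qed.

End argmax.

(** * Lipschitz constant of the gain *)

Section gain_lipschitz.
Context {R : realType} {p q n : nat}.
Variables (Q : R.-pker (cube R (p + q)) ~> (cube R p)) (LQ : R).
Hypotheses (LQ_ge0 : 0 <= LQ) (Q_lip : Q_lipschitz Q LQ).

Lemma state_dist (k k' : cube R (p + q)) :
  cube_dist (state k) (state k') <= cube_dist k k'.
Proof.
apply: rV_norm_le => [|i]; first exact: cube_dist_ge0.
rewrite !mxE.
by rewrite (le_trans _ (ler_rV_norm _ (lshift q i)))// !mxE.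
Qed.

(** The kernel contributes [LQ], as [sup_norm f <= lip_norm f]; the identity contributes 1, as the
    projection to states is 1-Lipschitz. *)
Lemma QIop_lipschitz (f : cube R p -> R) k k' : lipschitz_cube f ->
  `|QIop Q f k - QIop Q f k'| <= (LQ + 1) * lip_norm f * cube_dist k k'.
Proof.
move=> fL.
have f0 := lip_norm_ge0 f.
rewrite /QIop (_ : _ - _ - _ = (Qop Q f k - Qop Q f k') -
  (f (state k) - f (state k'))); last by ring.
rewrite (le_trans (ler_normB _ _))//.
rewrite -mulrA mulrDl mul1r lerD//.
  rewrite (le_trans (Q_lip f (lipschitz_cube_continuous f fL) k k'))//.
  by rewrite -mulrA ler_wpM2l// ler_wpM2r ?cube_dist_ge0// /lip_norm le_max lexx.
by rewrite (le_trans (lip_norm_lipschitz f _ _ fL))// ler_wpM2l// state_dist.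
Qed.

Lemma gain_lipschitz (psi : cube R (p + q) -> R) (u : 'I_n -> cube R p -> R)
    (rho : R) (alpha : 'rV[R]_n) k k' :
  lipschitz_cube psi -> (forall i, lipschitz_cube (u i)) ->
  (forall i, lip_norm (u i) <= 1) ->
  `|gain Q psi u rho alpha k - gain Q psi u rho alpha k'| <=
  (l1_norm alpha * (LQ + 1) + lip_norm psi) * cube_dist k k'.
Proof.
move=> psiL uL u1; rewrite /gain.
rewrite [X in `|X|](_ : _ = (psi k' - psi k) -
    \sum_i alpha ord0 i * (QIop Q (u i) k - QIop Q (u i) k')); last first.
  under [in RHS]eq_bigr do rewrite mulrBr.
  by rewrite sumrB; ring.
rewrite (le_trans (ler_normB _ _))// mulrDl addrC lerD//; last first.
  by rewrite distrC lip_norm_lipschitz.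
rewrite (le_trans (ler_norm_sum _ _ _))// /l1_norm !mulr_suml ler_sum// => i _.
rewrite normrM -mulrA ler_wpM2l// (le_trans (QIop_lipschitz _ _ _ (uL i)))//.
by rewrite ler_wpM2r ?cube_dist_ge0// ler_piMr// addr_ge0.
Qed.

End gain_lipschitz.

(** * Choice of the side length and conclusion *)

Theorem lemma5p10 (R : realType) (p q n : nat)
    (Q : R.-pker (cube R (p + q)) ~> (cube R p)) (LQ : R)
    (psi : cube R (p + q) -> R) (u : 'I_n -> cube R p -> R)
    (N : 'rV[R]_n -> R) (theta : R)
    (dimK_gt0 : (0 < p + q)%N)
    (LQ_gt0 : 0 < LQ)
    (Q_lip : Q_lipschitz Q LQ)
    (psi_ge0 : forall k, 0 <= psi k)
    (psi_lip : lipschitz_cube psi)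
    (u_lip : forall i, lipschitz_cube (u i))
    (u_norm : forall i, lip_norm (u i) = 1)
    (u_indep : lin_indep u)
    (N_norm : is_norm N)
    (theta_gt0 : 0 < theta) :
  let C : R := (p + q)%:R in
  let c : R := expR 1 / (p + q)%:R *
    (theta * varrho N * (Num.max LQ 1 + 1) + lip_norm psi) in
  forall (eta rho : R) (alpha : 'rV[R]_n) (y_star : probability (cube R (p + q)) R),
    0 < eta -> N alpha <= theta ->
    entropic_argmax (gain Q psi u rho alpha) eta y_star ->
    (rel_entropy y_star <= (C * Num.max (ln (c * eta^-1)) 1)%:E)%E.
Proof.
move=> C c eta rho alpha y eta0 alphaN ymax.
set L : R := theta * varrho N * (Num.max LQ 1 + 1) + lip_norm psi in c *.
have C0 : 0 < C by rewrite ltr0n.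
have M0 : 0 <= Num.max LQ 1 by rewrite le_max ler01 orbT.
have alpha1 := l1_norm_le_varrho theta alpha N_norm theta_gt0 alphaN.
have alpha0 : 0 <= l1_norm alpha by exact: sumr_ge0.
have psi0 := lip_norm_ge0 psi.
have L0 : 0 <= L.
  by rewrite addr_ge0// mulr_ge0 ?addr_ge0// (le_trans alpha0).
have gL k k' : `|gain Q psi u rho alpha k - gain Q psi u rho alpha k'| <=
    L * cube_dist k k'.
  have u1 i : lip_norm (u i) <= 1 by rewrite u_norm.
  apply: le_trans (gain_lipschitz Q LQ (ltW LQ_gt0) Q_lip
    _ _ rho alpha k k' psi_lip u_lip u1) _.
  rewrite ler_wpM2r ?cube_dist_ge0// lerD2r ler_pM// ?addr_ge0 ?(ltW LQ_gt0)//.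
  by rewrite lerD2r le_max lexx.
have bound r (r0 : 0 < r) (r1 : r <= 1) :=
  entropic_argmax_lipschitz _ _ _ _ _ eta0 L0 gL r0 r1 ymax.
(* If [L <= C * eta], side 1 gives the whole cube and the bound [L / eta <= C]. *)
have [LC|LC] := leP L (C * eta).
  apply: le_trans (bound 1 _ _) _ => //.
  rewrite lee_fin ln1 mulr0 subr0 mulr1 ler_pdivrMr// (le_trans LC)//.
  by rewrite ler_wpM2r ?(ltW eta0)// ler_peMr ?(ltW C0)// le_max lexx orbT.
have Lgt0 : 0 < L by apply: lt_trans LC; exact: mulr_gt0.
(* This side is the critical point of [L * r / eta - C * ln r]; it is below 1 in this case. *)
have r0 : 0 < C * eta / L by rewrite divr_gt0// mulr_gt0.
apply: le_trans (bound (C * eta / L) r0 _) _.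
  by rewrite ler_pdivrMr// mul1r ltW.
rewrite lee_fin.
have -> : L * (C * eta / L) / eta = C by field; rewrite !gt_eqF.
(* With [r = C * eta / L], the bound [C * (1 - ln r)] is [C * ln (expR 1 / r)], and [expR 1 / r] is
   [c * eta^-1]. *)
rewrite -{1}[C]mulr1 -/C -mulrBr ler_wpM2l ?(ltW C0)// le_max; apply/orP; left.
have -> : c * eta^-1 = expR 1 / (C * eta / L).
  by rewrite /c; field; rewrite -natrD !gt_eqF.
by rewrite [leRHS]ln_div ?posrE ?expR_gt0 ?expRK.
Qed.
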